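(* Let $T$ be an operator semigroup on a set $D$, let $S$ be a $T$-space and let $B\subseteq S$. Then the correspondences $$\gamma: H\mapsto S^{H}\qquad\text{and}\qquad \delta: K\mapsto \operatorname{GGr}_T(S/K)$$ define inclusion-inverting mutually inverse bijective maps between $\operatorname{GSGr}_T(S/B)$ and $\operatorname{Int}_T^{\operatorname{Aut}}(S/B)$ (that is, $\gamma:\operatorname{GSGr}_T(S/B)\to\operatorname{Int}_T^{\operatorname{Aut}}(S/B)$ is an inclusion-reversing bijection whose inverse is $\delta$, which is also inclusion-reversing).
   Context: An operator semigroup on a set $D$ is a (possibly empty) set $T$ of functions $D\to D$ closed under composition. For $U\subseteq D$ put $\langle U\rangle_T=\{f(u): f\in T,\ u\in U\}$; a $T$-space is a subset of $D$ of the form $\langle U\rangle_T$ for some $U\subseteq D$. (If $S$ is a $T$-space then $f(a)\in S$ for all $f\in T$, $a\in S$.) A $T$-morphism from a $T$-space $S$ to a $T$-space $S'$ is a map $\sigma:S\to S'$ with $\sigma(f(a))=f(\sigma(a))$ for all $a\in S$, $f\in T$. $\operatorname{Aut}_T(S)$ is the set of all bijective $T$-morphisms from $S$ to $S$. For $H\subseteq\operatorname{Aut}_T(S)$, $S^H=\{a\in S:\sigma(a)=a\ \forall\sigma\in H\}$ (so $S^{\emptyset}=S$). For $K\subseteq S$, $\operatorname{GGr}_T(S/K)=\{\sigma\in\operatorname{Aut}_T(S):\sigma(b)=b\ \forall b\in K\}$. For $B\subseteq S$, $$\operatorname{Int}_T^{\operatorname{Aut}}(S/B)=\{S^H: H\subseteq\operatorname{Aut}_T(S),\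 B\subseteq S^H\},\qquad \operatorname{GSGr}_T(S/B)=\{\operatorname{GGr}_T(S/K): B\subseteq K\subseteq S\}.$$ *)

(* Defs.v *)
From mathcomp Require Import all_boot.
From mathcomp Require Import boolp classical_sets functions.

Set Implicit Arguments.
Unset Strict Implicit.
Unset Printing Implicit Defensive.

Local Open Scope classical_set_scope.

Section OperatorSemigroup.
Variables (D : Type) (T : set (D -> D)).

Definition operator_semigroup : Prop :=
  forall f g, T f -> T g -> T (f \o g).

Definition Tspan (U : set D) : set D :=
  [set f u | f in T & u in U].

Definition Tspace (S : set D) : Prop := exists U : set D, S = Tspan U.

Lemma Tspace_stable (S : set D) (f : D -> D) (a : D) :
  operator_semigroup -> Tspace S -> T f -> S a -> S (f a).
Proof.
move=> Tcomp [U ->] Tf [g Tg [u Uu <-]].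
by exists (f \o g); [exact: Tcomp | exists u].
Qed.

(* Maps between subsets of D are functions between the subtypes [set_type].  *)
(* The membership proof [fa] gives f a as an element of S; when S is a       *)
(* T-space it always exists, by [Tspace_stable], so [fa] is no restriction.  *)
Definition Tmorphism (S S' : set D) (sigma : S -> S') : Prop :=
  forall f, T f -> forall (a : S) (fa : f (\val a) \in S),
    \val (sigma (Sub (f (\val a)) fa)) = f (\val (sigma a)).

Definition Aut (S : set D) : set (S -> S) :=
  [set sigma | Tmorphism sigma /\ bijective sigma].

Definition fixed_set (S : set D) (H : set (S -> S)) : set D :=
  [set \val a | a in [set a : S | forall sigma, H sigma -> sigma a = a]].

Definition GGr (S K : set D) : set (S -> S) :=
  [set sigma | Aut sigma /\ forall b : S, K (\val b) -> sigma b = b].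

Definition IntAut (S B : set D) : set (set D) :=
  [set fixed_set H | H in [set H : set (S -> S) |
                            H `<=` @Aut S /\ B `<=` fixed_set H]].

Definition GSGr (S B : set D) : set (set (S -> S)) :=
  [set GGr (S := S) K | K in [set K : set D | B `<=` K /\ K `<=` S]].

End OperatorSemigroup.

Arguments Aut {D} T S _.
Arguments fixed_set {D} S H _.
Arguments GGr {D} T S K _.
Arguments IntAut {D} T S B _.
Arguments GSGr {D} T S B _.

(* Main.v *)
Require Import Defs.
From mathcomp Require Import all_boot.
From mathcomp Require Import boolp classical_sets functions.

(** For a relation such as [sigma fixes a], the two maps sending a set on one
    side to everything related to it on the other form an antitone Galois
    connection: [K] lies in the fixed set of [H] exactly when [H] lies in the
    group fixing [K] ([sub_fixed_setE]).  Both maps therefore reverse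
    inclusion, and each of them is unchanged by a further round trip:
    [fixed_set (GGr (fixed_set H)) = fixed_set H] ([GGrK]) and
    [GGr (fixed_set (GGr K)) = GGr K] ([fixed_setK]).  An element of
    [IntAut T S B] is a fixed set and an element of [GSGr T S B] is a Galois
    group, so on these two families the maps are mutually inverse.  Lying
    above [B] is preserved because [K] lies in [fixed_set (GGr K)]. *)

Set Implicit Arguments.
Unset Strict Implicit.
Unset Printing Implicit Defensive.

Local Open Scope classical_set_scope.

Section GaloisConnection.
Variables (D : Type) (T : set (D -> D)) (S : set D).
Implicit Types (H : set (S -> S)) (K B : set D).

Lemma fixed_setP H (a : S) :
  fixed_set S H (\val a) <-> forall sigma, H sigma -> sigma a = a.
Proof.
split=> [[b fixb /val_inj <-] //|fixa].
by exists a.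
Qed.

Lemma fixed_set_sub H : fixed_set S H `<=` S.
Proof. by move=> _ [a _ <-]; exact: set_valP. Qed.

Lemma fixed_set_anti H1 H2 :
  H1 `<=` H2 -> fixed_set S H2 `<=` fixed_set S H1.
Proof.
move=> sH12 _ [a fixa <-]; apply/fixed_setP => sigma /sH12.
exact: fixa.
Qed.

Lemma GGr_anti K1 K2 : K1 `<=` K2 -> GGr T S K2 `<=` GGr T S K1.
Proof.
move=> sK12 sigma [Asigma fixK2]; split=> // b /sK12.
exact: fixK2.
Qed.

Lemma GGr_sub_Aut K : GGr T S K `<=` Aut T S.
Proof. by move=> sigma []. Qed.

(** Both inclusions say that every element of [H] fixes every point of [K]. *)
Lemma sub_fixed_setE H K : H `<=` Aut T S -> K `<=` S ->
  K `<=` fixed_set S H <-> H `<=` GGr T S K.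
Proof.
move=> sHA sKS; split=> [sKH sigma Hsigma|sHK a Ka].
  split=> [|b /sKH /fixed_setP]; [exact: sHA | exact].
have -> : a = \val (SigSub (mem_set (sKS _ Ka)) : S) by [].
apply/fixed_setP => sigma /sHK [_]; exact.
Qed.

Lemma sub_fixed_set_GGr K : K `<=` S -> K `<=` fixed_set S (GGr T S K).
Proof. by move=> sKS; apply/sub_fixed_setE => //; exact: GGr_sub_Aut. Qed.

Lemma sub_GGr_fixed_set H :
  H `<=` Aut T S -> H `<=` GGr T S (fixed_set S H).
Proof. by move=> sHA; apply/sub_fixed_setE => //; exact: fixed_set_sub. Qed.

Lemma GGrK H : H `<=` Aut T S ->
  fixed_set S (GGr T S (fixed_set S H)) = fixed_set S H.
Proof.
move=> sHA; apply/seteqP; split.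
  exact/fixed_set_anti/sub_GGr_fixed_set.
exact/sub_fixed_set_GGr/fixed_set_sub.
Qed.

Lemma fixed_setK K : K `<=` S ->
  GGr T S (fixed_set S (GGr T S K)) = GGr T S K.
Proof.
move=> sKS; apply/seteqP; split.
  exact/GGr_anti/sub_fixed_set_GGr.
exact/sub_GGr_fixed_set/GGr_sub_Aut.
Qed.

Lemma fixed_set_IntAut B H : GSGr T S B H -> IntAut T S B (fixed_set S H).
Proof.
move=> [K [sBK sKS] <-]; exists (GGr T S K) => //; split.
  exact: GGr_sub_Aut.
exact/(subset_trans sBK)/sub_fixed_set_GGr.
Qed.

Lemma GGr_GSGr B K : IntAut T S B K -> GSGr T S B (GGr T S K).
Proof.
move=> [H [_ sBH] <-]; exists (fixed_set S H) => //; split=> //.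
exact: fixed_set_sub.
Qed.

End GaloisConnection.

Lemma can_set_bij (X Y : Type) (A : set X) (B : set Y)
    (f : X -> Y) (g : Y -> X) :
  (forall x, A x -> B (f x)) -> (forall y, B y -> A (g y)) ->
  (forall x, A x -> g (f x) = x) -> (forall y, B y -> f (g y) = y) ->
  set_bij A B f.
Proof.
move=> fAB gBA fK gK; split=> //.
- by move=> x y /set_mem Ax /set_mem Ay fxy; rewrite -(fK x)// fxy fK.
- by move=> y By; exists (g y); [exact: gBA | exact: gK].
Qed.

Theorem corollary3p2p6 (D : Type) (T : set (D -> D)) (S B : set D)
    (hT : operator_semigroup T) (hS : Tspace T S) (hB : B `<=` S) :
  let gamma : set (S -> S) -> set D := fun H => fixed_set S H in
  let delta : set D -> set (S -> S) := fun K => GGr T S K in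
  [/\ set_bij (GSGr T S B) (IntAut T S B) gamma,
      set_bij (IntAut T S B) (GSGr T S B) delta,
      (forall H, GSGr T S B H -> delta (gamma H) = H) /\
      (forall K, IntAut T S B K -> gamma (delta K) = K),
      (forall H1 H2, GSGr T S B H1 -> GSGr T S B H2 ->
         H1 `<=` H2 -> gamma H2 `<=` gamma H1) &
      (forall K1 K2, IntAut T S B K1 -> IntAut T S B K2 ->
         K1 `<=` K2 -> delta K2 `<=` delta K1)].
Proof.
move=> gamma delta.
have gK H : GSGr T S B H -> delta (gamma H) = H.
  by move=> [K [_ sKS] <-]; exact: fixed_setK.
have dK K : IntAut T S B K -> gamma (delta K) = K.
  by move=> [H [sHA _] <-]; exact: GGrK.
have gI H : GSGr T S B H -> IntAut T S B (gamma H) by exact: fixed_set_IntAut.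
have dG K : IntAut T S B K -> GSGr T S B (delta K) by exact: GGr_GSGr.
split.
- exact: can_set_bij gI dG gK dK.
- exact: can_set_bij dG gI dK gK.
- by [].
- by move=> H1 H2 _ _; exact: fixed_set_anti.
- by move=> K1 K2 _ _; exact: GGr_anti.
Qed.
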